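(* Let $(x^k)_{k\in\mathbb{N}}$ be an infinite sequence generated by GInexPM with constant step size $\alpha$ satisfying $0<\alpha<(1-2\bar\gamma)/L$ (as described in the context), and assume that $-\infty<f^*$. If $\bar x\in C$ is a cluster point of $(x^k)_{k\in\mathbb{N}}$, then $\bar x$ is a stationary point of the problem $\min\{f(x): x\in C\}$, i.e. $\langle\nabla f(\bar x),x-\bar x\rangle\ge 0$ for all $x\in C$.
   Context: Setting. $C\subset\mathbb{R}^n$ is a nonempty closed convex set, $f:\mathbb{R}^n\to\mathbb{R}$ is continuously differentiable, $f^*:=\inf_{x\in C}f(x)$, $\langle\cdot,\cdot\rangle$ and $\|\cdot\|$ are the Euclidean inner product and norm, and $\mathbb{N}=\{0,1,2,\dots\}$. The gradient is Lipschitz on $C$ with constant $L>0$: $\|\nabla f(x)-\nabla f(y)\|\le L\|x-y\|$ for all $x,y\in C$. Inexact projection. For each $\gamma=(\gamma_1,\gamma_2,\gamma_3)\in\mathbb{R}^3_+$ (nonnegative entries), $\varphi_\gamma:\mathbb{R}^n\times\mathbb{R}^n\times\mathbb{R}^n\to[0,\infty)$ is a function with $\varphi_\gamma(u,v,w)\le\gamma_1\|v-u\|^2+\gamma_2\|w-v\|^2+\gamma_3\|w-u\|^2$ for all $u,v,w$. For $u\in C$ and $v\in\mathbb{R}^n$, $\mathcal{P}_C(\varphi_\gamma,u,v):=\{w\in C:\langle v-w,y-w\rangle\le\varphi_\gamma(u,v,w)\ \forall y\in C\}$. GInexPM with constant step size. Fix a nonincreasing sequence $(b_k)_{k\in\mathbb{N}}$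 of nonnegative reals converging to $0$, a real $b_{-1}>b_0$ with $b_{-1}>0$, and reals $a_k$ with $0\le a_k\le b_{k-1}-b_k$ for all $k\in\mathbb{N}$. Fix constants $\bar\gamma_2<1/2$, $\bar\gamma<1/2$ and a step size $\alpha$ with $0<\alpha<(1-2\bar\gamma)/L$. Start from $x^0\in C$. At iteration $k$: if $\nabla f(x^k)=0$ stop; otherwise choose reals $\gamma_1^k,\gamma_2^k,\gamma_3^k\ge 0$ with $\gamma_1^k+\gamma_2^k\le a_k/\|\nabla f(x^k)\|^2$, $\gamma_2^k<\bar\gamma_2$, $\gamma_3^k<\bar\gamma$, set $\gamma^k=(\gamma_1^k,\gamma_2^k,\gamma_3^k)$, $z^k:=x^k-\alpha\nabla f(x^k)$, and let $x^{k+1}$ be any element of $\mathcal{P}_C(\varphi_{\gamma^k},x^k,z^k)$. ''Infinite sequence generated'' means the algorithm never stops. *)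

(* Defs.v *)
From mathcomp Require Export all_boot all_order all_algebra.
From mathcomp Require Export all_classical all_reals all_analysis.
Export Order.TTheory GRing.Theory Num.Theory.
Export numFieldNormedType.Exports.

Set Implicit Arguments.
Unset Strict Implicit.
Unset Printing Implicit Defensive.

Local Open Scope classical_set_scope.
Local Open Scope ring_scope.

(* MathComp-Analysis, with R^n as 'rV[R]_n for an abstract R : realType.
   The library norm `|u| on 'rV[R]_n is the sup norm. It is used here only
   through the topology it induces (closed sets, continuity, differentiability,
   cluster points), which is the Euclidean one; every quantitative estimate is
   stated with enorm. *)
Definition dotp (R : realType) (n : nat) (u v : 'rV[R]_n) : R :=
  \sum_(i < n) u 0 i * v 0 i.

Definition enorm (R : realType) (n : nat) (u : 'rV[R]_n) : R :=
  Num.sqrt (dotp u u).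

Definition grad (R : realType) (n : nat) (f : 'rV[R]_n -> R) (x : 'rV[R]_n) :
    'rV[R]_n :=
  \row_(i < n) 'D_(delta_mx 0 i) f x.

Definition continuously_differentiable (R : realType) (n : nat)
    (f : 'rV[R]_n -> R) : Prop :=
  (forall x, differentiable f x) /\ continuous (grad f).

Definition lipschitz_gradient_on (R : realType) (n : nat) (C : set 'rV[R]_n)
    (f : 'rV[R]_n -> R) (L : R) : Prop :=
  forall x y, C x -> C y ->
    enorm (grad f x - grad f y) <= L * enorm (x - y).

Definition inf_value (R : realType) (n : nat) (C : set 'rV[R]_n)
    (f : 'rV[R]_n -> R) : \bar R :=
  ereal_inf [set (f x)%:E | x in C].

(* phi g1 g2 g3 is the function indexed by the triple (g1, g2, g3); only its
   values at nonnegative triples are constrained, and only these are used. *)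
Definition error_tolerance (R : realType) (n : nat)
    (phi : R -> R -> R -> 'rV[R]_n -> 'rV[R]_n -> 'rV[R]_n -> R) : Prop :=
  forall g1 g2 g3, 0 <= g1 -> 0 <= g2 -> 0 <= g3 ->
  forall u v w,
    0 <= phi g1 g2 g3 u v w /\
    phi g1 g2 g3 u v w <= g1 * enorm (v - u) ^+ 2 + g2 * enorm (w - v) ^+ 2
                          + g3 * enorm (w - u) ^+ 2.

Definition inexact_proj (R : realType) (n : nat) (C : set 'rV[R]_n)
    (phi : 'rV[R]_n -> 'rV[R]_n -> 'rV[R]_n -> R) (u v : 'rV[R]_n) :
    set 'rV[R]_n :=
  [set w | C w /\ forall y, C y -> dotp (v - w) (y - w) <= phi u v w].

(* The index -1 is represented by a separate real: bm1 is b_{-1}, and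
   shifted bm1 b k is b_{k-1}. *)
Definition shifted (R : realType) (bm1 : R) (b : nat -> R) (k : nat) : R :=
  if k is j.+1 then b j else bm1.

Definition error_sequences (R : realType) (bm1 : R) (b a : nat -> R) : Prop :=
  [/\ nonincreasing_seq b,
      forall k, 0 <= b k,
      b @ \oo --> (0 : R),
      b 0%N < bm1 /\ 0 < bm1
    & forall k, 0 <= a k <= shifted bm1 b k - b k].

(* The condition grad f (x k) <> 0 for all k says that the stopping test never
   succeeds, so that the whole sequence x is produced. *)
Definition GInexPM_generated (R : realType) (n : nat) (C : set 'rV[R]_n)
    (f : 'rV[R]_n -> R)
    (phi : R -> R -> R -> 'rV[R]_n -> 'rV[R]_n -> 'rV[R]_n -> R)
    (a : nat -> R) (gbar2 gbar alpha : R) (x : nat -> 'rV[R]_n) : Prop :=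
  C (x 0%N) /\
  exists g1 g2 g3 : nat -> R, forall k,
    [/\ grad f (x k) <> 0,
        [/\ 0 <= g1 k, 0 <= g2 k & 0 <= g3 k],
        g1 k + g2 k <= a k / enorm (grad f (x k)) ^+ 2,
        g2 k < gbar2 /\ g3 k < gbar
      & inexact_proj C (phi (g1 k) (g2 k) (g3 k))
          (x k) (x k - alpha *: grad f (x k)) (x k.+1)].

Definition stationary_point (R : realType) (n : nat) (C : set 'rV[R]_n)
    (f : 'rV[R]_n -> R) (xbar : 'rV[R]_n) : Prop :=
  C xbar /\ forall x, C x -> 0 <= dotp (grad f xbar) (x - xbar).

(* Main.v *)
Require Import Defs.
From mathcomp Require Import all_boot all_order all_algebra.
From mathcomp Require Import all_classical all_reals all_analysis.
From mathcomp Require Import ring lra.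
Import Order.TTheory GRing.Theory Num.Theory.
Import numFieldNormedType.Exports.
Local Open Scope classical_set_scope.
Local Open Scope ring_scope.

(** Write d_k = x_{k+1} - x_k. Testing the inexact projection against a point
    y of C and bounding the tolerance gives [inexact_proj_ineq], in which the
    relative error gamma_1 + gamma_2 <= a_k / |grad f (x_k)|^2 turns the
    gradient terms into alpha^2 a_k, which is summable.

    With y = x_k that inequality bounds the slope <grad f (x_k), d_k> from above
    by a multiple of a_k minus ((1 - gbar) / alpha) |d_k|^2
    ([slope_upper_bound]). Moving from x_k to x_{k+1} costs at most a further
    L |d_k|^2 ([lipschitz_descent]), and (1 - gbar) / alpha > L by the choice of
    alpha, because gbar > gamma_3^k >= 0. Since a_k <= b_{k-1} - b_k, the
    quantities f (x_k) + c1 b_{k-1} therefore decrease by at least c2 |d_k|^2 at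
    each iteration. They are bounded below, so d_k tends to 0
    ([cvg0_of_decrease]).

    With an arbitrary y in C the same inequality says that
    alpha <grad f (x_k), y - x_k> is at least
    - |d_k| (alpha |grad f (x_k)| + |y - x_k|) - alpha^2 a_k. The factor of
    |d_k| is a continuous function of x_k, hence bounded near a cluster point,
    and the stationarity inequality survives in the limit ([cluster_ge0]). *)

(** * Euclidean inner product and norm *)

Section EuclideanSpace.
Context (R : realType) (n : nat).
Implicit Types (u v w : 'rV[R]_n) (t : R).

Lemma dotpC u v : dotp u v = dotp v u.
Proof. by apply: eq_bigr => i _; rewrite mulrC. Qed.

Lemma dotpDl u v w : dotp (u + v) w = dotp u w + dotp v w.
Proof. by rewrite -big_split; apply: eq_bigr => i _; rewrite mxE mulrDl. Qed.

Lemma dotpZl t u v : dotp (t *: u) v = t * dotp u v.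
Proof. by rewrite mulr_sumr; apply: eq_bigr => i _; rewrite mxE mulrA. Qed.

Lemma dotpNl u v : dotp (- u) v = - dotp u v.
Proof. by rewrite -scaleN1r dotpZl mulN1r. Qed.

Lemma dotpDr u v w : dotp u (v + w) = dotp u v + dotp u w.
Proof. by rewrite dotpC dotpDl !(dotpC u). Qed.

Lemma dotpZr t u v : dotp u (t *: v) = t * dotp u v.
Proof. by rewrite dotpC dotpZl dotpC. Qed.

Lemma dotpNr u v : dotp u (- v) = - dotp u v.
Proof. by rewrite dotpC dotpNl dotpC. Qed.

Definition dotpE := (dotpDl, dotpNl, dotpZl, dotpDr, dotpNr, dotpZr).

Lemma dotp_ge0 u : 0 <= dotp u u.
Proof. by apply: sumr_ge0 => i _; rewrite -expr2 sqr_ge0. Qed.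

Lemma dotp_eq0 u v : dotp u u = 0 -> dotp u v = 0.
Proof.
move=> u0; apply: big1 => i _.
have /(_ i isT)/eqP := psumr_eq0P (fun i _ => sqr_ge0 (u 0 i)) u0.
by rewrite sqrf_eq0 => /eqP ->; rewrite mul0r.
Qed.

Lemma enorm_ge0 u : 0 <= enorm u.
Proof. exact: sqrtr_ge0. Qed.

Lemma enorm_sqr u : enorm u ^+ 2 = dotp u u.
Proof. by rewrite sqr_sqrtr ?dotp_ge0. Qed.

Lemma enormZ t u : enorm (t *: u) = `|t| * enorm u.
Proof.
by rewrite /enorm dotpZl dotpZr mulrA -expr2 sqrtrM ?sqr_ge0// sqrtr_sqr.
Qed.

(** Nonnegativity of <w, w> for w = <v, v> u - <u, v> v, which equals
    <v, v> (<u, u> <v, v> - <u, v>^2). *)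
Lemma cauchy_schwarz u v : `|dotp u v| <= enorm u * enorm v.
Proof.
rewrite -(@ler_pXn2r _ 2) ?nnegrE ?mulr_ge0 ?enorm_ge0//.
rewrite real_normK ?num_real// exprMn !enorm_sqr.
have [v0|v0] := eqVneq (dotp v v) 0.
  by rewrite v0 mulr0 dotpC (dotp_eq0 _ _ v0) expr0n.
have {}v0 : 0 < dotp v v by rewrite lt0r v0 dotp_ge0.
have := dotp_ge0 (dotp v v *: u - dotp u v *: v).
rewrite !dotpE (dotpC v u) => h.
rewrite -subr_ge0 -(pmulr_rge0 _ v0); lra.
Qed.

Lemma cvg_dotp {T : Type} {F : set_system T} {FF : Filter F}
    (g h : T -> 'rV[R]_n) u v :
  g @ F --> u -> h @ F --> v -> dotp (g t) (h t) @[t --> F] --> dotp u v.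
Proof.
move=> gu hv; apply: cvg_big => [|i _]; first exact: add_continuous.
apply: cvgM.
  exact: (cvg_comp _ _ gu (@coord_continuous _ _ _ 0 i u)).
exact: (cvg_comp _ _ hv (@coord_continuous _ _ _ 0 i v)).
Qed.

Lemma cvg_enorm {T : Type} {F : set_system T} {FF : Filter F}
    (g : T -> 'rV[R]_n) u :
  g @ F --> u -> enorm (g t) @[t --> F] --> enorm u.
Proof.
move=> gu; apply: (cvg_comp _ _ (cvg_dotp _ _ _ _ gu gu)).
exact: sqrt_continuous.
Qed.

End EuclideanSpace.

(** * Descent along segments of the constraint set *)

Section Descent.
Context (R : realType) (n : nat) (f : 'rV[R]_n -> R).
Implicit Types x d w : 'rV[R]_n.

Lemma derive_dotp_grad x d : differentiable f x -> 'D_d f x = dotp (grad f x) d.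
Proof.
move=> fx; rewrite deriveE// {1}(row_sum_delta d) linear_sum.
by apply: eq_bigr => i _; rewrite linearZ mxE deriveE// mulrC.
Qed.

Lemma is_derive_line x d (t : R) : differentiable f (x + t *: d) ->
  is_derive t 1 (fun s : R => f (x + s *: d)) (dotp (grad f (x + t *: d)) d).
Proof.
move=> fx; rewrite -derive_dotp_grad//.
have E : (fun h : R => h^-1 *: (((fun s : R => f (x + s *: d)) \o shift t) (h *: 1)
            - f (x + t *: d))) =
         (fun h : R => h^-1 *: ((f \o shift (x + t *: d)) (h *: d)
            - f (x + t *: d))).
  apply/funext => h /=; congr (_ *: (f _ - _)).
  by rewrite [h *: 1]mulr1 scalerDl addrCA.
apply: DeriveDef; last by rewrite /derive E.
by rewrite /derivable E; exact: diff_derivable.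
Qed.

(** By the mean value theorem f w - f x is a slope <grad f z, w - x> with z on
    the segment [x, w], which convexity keeps inside C, where the gradient is
    Lipschitz. The sharper constant L / 2 would require integrating the
    gradient; L is small enough for the step size at hand. *)
Lemma lipschitz_descent (C : set 'rV[R]_n) (L : R) x w :
  convex_set C -> (forall u, differentiable f u) ->
  0 <= L -> lipschitz_gradient_on C f L -> C x -> C w ->
  f w <= f x + dotp (grad f x) (w - x) + L * enorm (w - x) ^+ 2.
Proof.
move=> convC df L0 lipf Cx Cw; set d := w - x.
have der t := is_derive_line _ _ _ (df (x + t *: d)).
have [|t t01] := MVT_segment ler01 (fun t _ => der t).
  by apply: derivable_within_continuous => t _; have [] := der t.
rewrite scale1r scale0r addr0 subr0 mulr1 (addrC x d) subrK.
move: t01; rewrite in_itv/= => /andP[t0 t1] fE.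
(* x + t d is the convex combination t w + (1 - t) x. *)
have Ct : C (x + t *: d).
  have := convC w x (Itv01 t0 t1); rewrite !inE => /(_ Cw Cx).
  suff -> : (x + t *: d) = conv (Itv01 t0 t1) (w : convex_lmodType _) x by [].
  by rewrite /conv/= scalerBl scale1r scalerBr addrCA.
have gt : enorm (grad f (x + t *: d) - grad f x) <= L * enorm d.
  apply: le_trans (lipf _ _ Ct Cx) _; apply: ler_wpM2l => //.
  by rewrite addrC addKr enormZ ger0_norm// ler_piMl ?enorm_ge0.
have := le_trans (ler_norm _)
  (cauchy_schwarz _ _ (grad f (x + t *: d) - grad f x) d).
move=> /le_trans/(_ (ler_wpM2r (enorm_ge0 _ _ d) gt)).
by rewrite dotpDl dotpNl -fE expr2 mulrA; lra.
Qed.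

End Descent.

(** * One inexact projected gradient step *)

Section InexactProjection.
Context (R : realType) (n : nat).

(** The defining inequality of the inexact projection, with z = u - alpha g
    eliminated: w - z = (w - u) + alpha g is expanded on both sides, so that
    gamma_2 |w - z|^2 contributes to the slope <g, w - u>, to |w - u|^2 and to
    |g|^2. Keeping the slope and the square of the displacement on the left
    serves both the decrease (y = u) and the limit (y arbitrary). *)
Lemma inexact_proj_ineq (C : set 'rV[R]_n)
    (phi : R -> R -> R -> 'rV[R]_n -> 'rV[R]_n -> 'rV[R]_n -> R)
    (g1 g2 g3 a alpha : R) (g u w y : 'rV[R]_n) :
  error_tolerance phi -> 0 <= g1 -> 0 <= g2 -> 0 <= g3 ->
  g <> 0 -> g1 + g2 <= a / enorm g ^+ 2 ->
  inexact_proj C (phi g1 g2 g3) u (u - alpha *: g) w -> C y ->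
  alpha * (1 - 2 * g2) * dotp g (w - u) + (1 - g2 - g3) * enorm (w - u) ^+ 2
    <= alpha * dotp g (y - u) + dotp (w - u) (y - u) + alpha ^+ 2 * a.
Proof.
move=> tol g1_ge0 g2_ge0 g3_ge0 gN0 ga [_ projw] Cy.
have [_ phi_le] := tol _ _ _ g1_ge0 g2_ge0 g3_ge0 u (u - alpha *: g) w.
have {projw phi_le} := le_trans (projw _ Cy) phi_le.
(* Only a nonzero gradient allows clearing the denominator in the bound on
   g1 + g2. *)
have nz : 0 < enorm g ^+ 2.
  rewrite enorm_sqr lt0r dotp_ge0 andbT; apply/eqP => gg0; apply: gN0.
  apply/rowP => i; rewrite mxE.
  have := dotp_eq0 _ _ g (delta_mx 0 i) gg0.
  rewrite /dotp (bigD1 i)//= big1 => [|j /negPf ji].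
    by rewrite mxE !eqxx mulr1 addr0.
  by rewrite mxE ji mulr0.
move: ga; rewrite ler_pdivlMr// !enorm_sqr => ga.
have {}ga : alpha ^+ 2 * ((g1 + g2) * dotp g g) <= alpha ^+ 2 * a.
  by rewrite ler_wpM2l ?sqr_ge0.
rewrite !dotpE !(dotpC _ _ u) ?(dotpC _ _ g) ?(dotpC _ _ w y).
lra.
Qed.

(** Dividing the hypothesis by 1 - 2 g2 is what would isolate p; since
    1 - g2 - g3 = (1 - 2 g2) (1 - g3) + g2 (1 - 2 g3), the coefficient of s stays
    at least 1 - gbar after that division, uniformly in g2 and g3. *)
Lemma slope_upper_bound (g2 g3 gbar2 gbar a alpha p s : R) :
  0 <= g2 -> g2 < gbar2 -> gbar2 < 1 / 2 -> g3 < gbar -> gbar < 1 / 2 ->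
  0 < alpha -> 0 <= a -> 0 <= s ->
  alpha * (1 - 2 * g2) * p + (1 - g2 - g3) * s <= alpha ^+ 2 * a ->
  p <= alpha / (1 - 2 * gbar2) * a - (1 - gbar) / alpha * s.
Proof.
move=> g2_ge0 g2_lt gbar2_lt g3_lt gbar_lt alpha0 a0 s0 h.
have e0 : 0 < 1 - 2 * gbar2 by lra.
rewrite -subr_ge0 -(pmulr_rge0 _ alpha0) -(pmulr_rge0 _ e0).
suff : (1 - 2 * gbar2) * (alpha * p + (1 - gbar) * s) <= alpha ^+ 2 * a.
  suff -> : (1 - 2 * gbar2) * (alpha * (alpha / (1 - 2 * gbar2) * a
      - (1 - gbar) / alpha * s - p)) = alpha ^+ 2 * a
      - (1 - 2 * gbar2) * (alpha * p + (1 - gbar) * s) by rewrite subr_ge0.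
  by field; apply/andP; split; lra.
have h1 : (1 - 2 * g2) * (alpha * p + (1 - gbar) * s) <= alpha ^+ 2 * a.
  apply: le_trans h; rewrite -subr_ge0.
  have -> : alpha * (1 - 2 * g2) * p + (1 - g2 - g3) * s
     - (1 - 2 * g2) * (alpha * p + (1 - gbar) * s)
     = (g2 * (1 - 2 * gbar) + (gbar - g3)) * s by ring.
  by apply: mulr_ge0 => //; apply: addr_ge0; [apply: mulr_ge0 |]; lra.
(* 1 - 2 g2 may be replaced by the smaller 1 - 2 gbar2 only where it multiplies
   a nonnegative number; otherwise the claim holds by sign. *)
have [X0|X0] := leP 0 (alpha * p + (1 - gbar) * s).
  by apply: le_trans h1; rewrite ler_wpM2r//; lra.
apply: (@le_trans _ _ 0); first by rewrite mulr_ge0_le0// ltW.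
by rewrite mulr_ge0 ?sqr_ge0.
Qed.

End InexactProjection.

(** * Limits of sequences *)

Section Sequences.
Context (R : realType).
Implicit Types V v : nat -> R.

(** V converges by monotonicity, so its increments, which dominate v, vanish. *)
Lemma cvg0_of_decrease V v (m : R) :
  (forall k, m <= V k) -> (forall k, 0 <= v k) ->
  (forall k, V k.+1 + v k <= V k) -> v @ \oo --> (0 : R).
Proof.
move=> mV v0 dV.
have cV : cvgn V.
  apply: nonincreasing_is_cvgn.
    by apply/nonincreasing_seqP => k; have := v0 k; have := dV k; lra.
  by exists m => _ [k _ <-].
apply: (@squeeze_cvgr _ _ _ _ (cst 0) (fun k => V k - V k.+1)).
- by near=> k; rewrite /= v0/=; have := dV k; lra.
- exact: cvg_cst.
- rewrite -(subrr (limn V)); apply: cvgB => //.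
  by move: cV; rewrite -(cvg_shiftS V).
Unshelve. all: by end_near. Qed.

(** Passing to the limit at a cluster point without extracting a subsequence:
    if G p < 0, then G stays below G p / 2 and H below a constant M on a
    neighbourhood of p, which the sequence visits at an index so late that
    s M + t is smaller than - G p / 2. The sequence (H (x k)) itself may be
    unbounded. *)
Lemma cluster_ge0 {T : topologicalType} (x : nat -> T) (p : T) (G H : T -> R)
    (s t : nat -> R) :
  cluster (x @ \oo) p -> {for p, continuous G} -> {for p, continuous H} ->
  s @ \oo --> (0 : R) -> t @ \oo --> (0 : R) -> (forall k, 0 <= s k) ->
  (forall k, 0 <= G (x k) + s k * H (x k) + t k) -> 0 <= G p.
Proof.
move=> clp cG cH s0 t0 s_ge0 key; rewrite leNgt; apply/negP => Gp.
pose M := `|H p| + 1.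
have M0 : 0 < M by rewrite /M; have := normr_ge0 (H p); lra.
have nearU : \forall u \near p, G u < G p / 2 /\ H u < M.
  near=> u; split; near: u; apply: cvgr_lt.
  - exact: cG.
  - lra.
  - exact: cH.
  - by rewrite /M; have := ler_norm (H p); lra.
have nearK : \forall k \near \oo, s k * M + t k < - (G p / 2).
  have st : s k * M + t k @[k --> \oo] --> (0 : R).
    by rewrite -[0](addr0 (0 : R)) -[X in X + _](mul0r M); apply: cvgD => //;
      apply: cvgM => //; exact: cvg_cst.
  by apply: (cvgr_lt _ st); lra.
have imK : (x @ \oo) (x @` [set k | s k * M + t k < - (G p / 2)]).
  by apply: filterS nearK => k ? /=; exists k.
have [_ [[k /= sk <-] [Gu Hu]]] := clp _ _ imK nearU.
have := key k; have := ler_wpM2l (s_ge0 k) (ltW Hu); lra.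
Unshelve. all: by end_near. Qed.

End Sequences.

(** * Stationarity of cluster points *)

Theorem theorem6 (R : realType) (n : nat) (C : set 'rV[R]_n)
    (f : 'rV[R]_n -> R) (L : R)
    (phi : R -> R -> R -> 'rV[R]_n -> 'rV[R]_n -> 'rV[R]_n -> R)
    (bm1 : R) (b a : nat -> R) (gbar2 gbar alpha : R)
    (x : nat -> 'rV[R]_n) (xbar : 'rV[R]_n)
    (C_nonempty : C !=set0) (C_closed : closed C) (C_convex : convex_set C)
    (f_C1 : continuously_differentiable f)
    (L_gt0 : 0 < L) (f_lip : lipschitz_gradient_on C f L)
    (phi_tol : error_tolerance phi)
    (ba_seq : error_sequences bm1 b a)
    (gbar2_lt : gbar2 < 1 / 2) (gbar_lt : gbar < 1 / 2)
    (alpha_gt0 : 0 < alpha) (alpha_lt : alpha < (1 - 2 * gbar) / L)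
    (x_gen : GInexPM_generated C f phi a gbar2 gbar alpha x)
    (f_bounded : (-oo < inf_value C f)%E)
    (xbar_C : C xbar) (xbar_cluster : cluster (x @ \oo) xbar) :
  stationary_point C f xbar.
Proof.
have [f_diff grad_cont] := f_C1.
have [b_noninc b_ge0 b_cvg [b0_lt bm1_gt0] a_bounds] := ba_seq.
have [x0_C [g1 [g2 [g3 step]]]] := x_gen.
have x_C k : C (x k) by case: k => // k; have [_ _ _ _ []] := step k.
have a_ge0 k : 0 <= a k by have /andP[] := a_bounds k.
have bs_ge0 k : 0 <= shifted bm1 b k by case: k => //=; exact: ltW.
pose d k := x k.+1 - x k.
have ineq k y : C y -> alpha * (1 - 2 * g2 k) * dotp (grad f (x k)) (d k)
      + (1 - g2 k - g3 k) * enorm (d k) ^+ 2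
    <= alpha * dotp (grad f (x k)) (y - x k) + dotp (d k) (y - x k)
       + alpha ^+ 2 * a k.
  move=> Cy; have [gN0 [? ? ?] ga _ proj] := step k.
  exact: (inexact_proj_ineq _ _ _ _ _ _ _ _ _ _ _ _ _ phi_tol _ _ _ gN0 ga
    proj Cy).
(* The only source of positivity of gbar is that it exceeds some gamma_3. *)
have gbar_gt0 : 0 < gbar by have [_ [_ _ ?] _ [_ ?] _] := step 0%N; lra.
pose c1 := alpha / (1 - 2 * gbar2); pose c2 := (1 - gbar) / alpha - L.
have c1_ge0 : 0 <= c1 by apply: divr_ge0; lra.
(* alpha L < 1 - 2 gbar < 1 - gbar. *)
have c2_gt0 : 0 < c2.
  rewrite subr_gt0 ltr_pdivlMr//; move: alpha_lt; rewrite ltr_pdivlMr//; lra.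
have decrease k : f (x k.+1) <= f (x k) + c1 * a k - c2 * enorm (d k) ^+ 2.
  have := lipschitz_descent _ _ _ _ _ _ _ C_convex f_diff (ltW L_gt0) f_lip
    (x_C k) (x_C k.+1).
  have := ineq k _ (x_C k).
  have [_ [_ g2_ge0 _] _ [g2_lt g3_lt] _] := step k.
  (* With y = x k the terms in y - x k vanish: 0 is written 0 *: 0 so that
     bilinearity removes them. *)
  rewrite subrr -(scale0r (0 : 'rV[R]_n)) !dotpZr !mul0r mulr0 !add0r.
  move=> /(slope_upper_bound _ _ _ _ _ _ _ _ _ g2_ge0 g2_lt gbar2_lt g3_lt
    gbar_lt alpha_gt0 (a_ge0 k) (sqr_ge0 _)).
  by rewrite -/c1 /c2 -/(d k) mulrBl; lra.
(* C being nonempty, the infimum is not +oo either, hence is a real number. *)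
have [m f_ge] : exists m, forall y, C y -> m <= f y.
  have inf_le y : C y -> (inf_value C f <= (f y)%:E)%E.
    by move=> Cy; apply: ereal_inf_lbound; exists y.
  case: (inf_value C f) f_bounded inf_le => [r _ inf_le|_ inf_le|//].
    by exists r => y /inf_le; rewrite lee_fin.
  by have := inf_le _ x0_C; rewrite leye_eq.
have dsq_cvg : c2 * enorm (d k) ^+ 2 @[k --> \oo] --> (0 : R).
  apply: (cvg0_of_decrease _ (fun k => f (x k) + c1 * shifted bm1 b k) _ m) => k.
  - have := f_ge _ (x_C k); have := mulr_ge0 c1_ge0 (bs_ge0 k).
    by rewrite /=; lra.
  - by rewrite mulr_ge0 ?sqr_ge0// ltW.
  - have /andP[_] := a_bounds k => /(ler_wpM2l c1_ge0).
    by have := decrease k; rewrite /= mulrBr; lra.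
have d_cvg : enorm (d k) @[k --> \oo] --> (0 : R).
  have -> : (fun k => enorm (d k)) =
            (fun k => Num.sqrt (c2^-1 * (c2 * enorm (d k) ^+ 2))).
    apply/funext => k; rewrite mulKf ?lt0r_neq0// sqrtr_sqr ger0_norm//.
    exact: enorm_ge0.
  rewrite -(@sqrtr0 R) -[X in _ --> Num.sqrt X](mulr0 c2^-1).
  apply: (cvg_comp _ _ (cvgM (cvg_cst _) dsq_cvg)); exact: sqrt_continuous.
have a_cvg : alpha ^+ 2 * a k @[k --> \oo] --> (0 : R).
  rewrite -(mulr0 (alpha ^+ 2)); apply: cvgM; first exact: cvg_cst.
  apply: (@squeeze_cvgr _ _ _ _ (cst 0) (shifted bm1 b)).
  - by near=> k; have := b_ge0 k; have /andP[] := a_bounds k; rewrite /=; lra.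
  - exact: cvg_cst.
  - by rewrite -(cvg_shiftS (shifted bm1 b)).
split=> // y y_C; rewrite -(pmulr_rge0 _ alpha_gt0).
have sub_cvg : y - u @[u --> xbar] --> y - xbar.
  exact: (cvgB (cvg_cst y) (@cvg_id _ (nbhs xbar))).
have slope_cvg : alpha * dotp (grad f u) (y - u) @[u --> xbar]
    --> alpha * dotp (grad f xbar) (y - xbar).
  exact: (cvgM (cvg_cst alpha) (cvg_dotp _ _ _ _ _ _ (grad_cont xbar) sub_cvg)).
have weight_cvg : alpha * enorm (grad f u) + enorm (y - u) @[u --> xbar]
    --> alpha * enorm (grad f xbar) + enorm (y - xbar).
  apply: cvgD (cvg_enorm _ _ _ _ sub_cvg).
  exact: (cvgM (cvg_cst alpha) (cvg_enorm _ _ _ _ (grad_cont xbar))).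
apply: (cluster_ge0 _ _ _ _ _ _ _ xbar_cluster slope_cvg weight_cvg d_cvg a_cvg)
  => k; first exact: enorm_ge0.
have [_ [_ g2_ge0 g3_ge0] _ [g2_lt g3_lt] _] := step k.
have := ineq k y y_C.
have := le_trans (ler_norm _) (cauchy_schwarz _ _ (d k) (y - x k)).
have := cauchy_schwarz _ _ (grad f (x k)) (d k).
rewrite ler_norml => /andP[+ _].
have := enorm_ge0 _ _ (grad f (x k)); have := enorm_ge0 _ _ (d k).
set p := dotp _ (d k); set G := enorm (grad _ _); set s := enorm (d k).
move=> s_ge0 G_ge0 lbp dy key.
(* Both gammas are below 1 / 2, so the square on the left can be dropped, and
   the slope is bounded through Cauchy-Schwarz as 0 <= 1 - 2 g2 <= 1. *)
have e0 : 0 <= (1 - g2 k - g3 k) * s ^+ 2 by rewrite mulr_ge0 ?sqr_ge0//; lra.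
have e1 : - (alpha * (G * s)) <= alpha * (1 - 2 * g2 k) * p.
  have Gs : 0 <= G * s by exact: mulr_ge0.
  rewrite -mulrA -mulrN ler_pM2l//.
  apply: (@le_trans _ _ ((1 - 2 * g2 k) * - (G * s))).
    by rewrite mulrN lerN2 ler_piMl//; lra.
  by rewrite ler_wpM2l//; lra.
lra.
Unshelve. all: by end_near. Qed.
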